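(* Let $G$ be a group generated by a set $\Sigma$ and let $A=\bigoplus_{i\in\Omega}\langle t_i\rangle$ be a discretely ordered abelian group as described in the context. Then the canonical homomorphism $G\to \mathrm{E}(A,G)$, sending the element of $G$ represented by a finite word $w\in\Gamma^*$ to the class of $w$ in $\mathrm{E}(A,G)$, is an embedding (i.e. injective).
   Context: Ordered group $A$. $\Omega$ is a set of ordinals with least element $0$; $A=\bigoplus_{i\in\Omega}\langle t_i\rangle$ with each $\langle t_i\rangle\cong\mathbb{Z}$. For $\alpha=\sum_i n_it_i\neq 0$, $\deg(\alpha)$ is the greatest $i$ with $n_i\ne 0$; $\alpha$ is positive if $n_{\deg(\alpha)}>0$; $\alpha\le\beta$ iff $\alpha=\beta$ or $\beta-\alpha$ is positive. $\mathbb{Z}$ is a subgroup of $A$ via $n\mapsto nt_0$, so $1=t_0$ is the least positive element. Words. $G$ is generated by $\Sigma$, where $a\ne1$ in $G$ for all $a\in\Sigma$; $\Gamma=\Sigma\cup\Sigma^{-1}\subseteq G$, $\overline a=a^{-1}$ for $a\in\Gamma$, and $\pi:\Gamma^*\to G$ is the induced monoid homomorphism. A (closed) $A$-word of length $\alpha\ge 0$ is a map $p:[1,\alpha]\to\Gamma$, where $[1,\alpha]=\{\beta\in A: 1\le\beta\le\alpha\}$; $|p|=\alpha$. $W(A,\Gamma)$ is the monoid of $A$-words under concatenation: $(p\cdot q)(\beta)=p(\beta)$ for $1\le\beta\le|p|$ and $(p\cdot q)(\beta)=q(\beta-|p|)$ for $|p|<\beta\le|p|+|q|$. The involution is $\overline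 p(\beta)=\overline{p(|p|+1-\beta)}$. A word is finite if $|p|\in\mathbb{N}$; finite words are identified with elements of $\Gamma^*$. A word $x$ is $G$-reduced if no non-empty finite factor of $x$ (a finite $f\neq 1$ with $x=pfq$) equals $1$ in $G$ under $\pi$. $R(A,G)$ is the set of $G$-reduced words and $R^*(A,G)$ the submonoid of $W(A,\Gamma)$ generated by $R(A,G)$. The group $\mathrm{E}(A,G)$. $\mathcal{M}(A,G)$ is the quotient monoid of $W(A,\Gamma)$ by the relations $u\,\ell\,\overline{r}\,\overline{u}=1$ for all $u\in R(A,G)$ and $\ell,r\in\Gamma^*$ with $\pi(\ell)=\pi(r)$. $\mathrm{E}(A,G)$ is the image of $R^*(A,G)$ in $\mathcal{M}(A,G)$; it is a group, and the inverse of the class of $u\in R(A,G)$ is the class of $\overline u$. *)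

(* Defs.v *)
From HB Require Import structures.
From mathcomp Require Import ssreflect ssrfun ssrbool eqtype ssrnat seq choice.
From mathcomp Require Import monoid bigop generic_quotient order.
From mathcomp Require Import ssralg ssrnum ssrint.
From mathcomp Require Import boolp classical_sets freeg.
From mathcomp Require Import zify.

Set Implicit Arguments.
Unset Strict Implicit.
Unset Printing Implicit Defensive.

Import Order.TTheory GRing.Theory Num.Theory.

Local Open Scope ring_scope.

(* A set of ordinals with least element 0 is represented, up to the unique
   order isomorphism, by a [bOrderType] whose strict order is well-founded
   (well-foundedness is an explicit hypothesis of the theorem). *)

Section OrderedGroup.
Context {disp : Order.disp_t} (Omega : bOrderType disp).

Definition ordgroup : Type := {freeg Omega}.
HB.instance Definition _ := GRing.Zmodule.on ordgroup.

Implicit Types (a b c : ordgroup) (i j : Omega).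

(* Junk value \bot at a = 0. Not to be confused with [freeg.deg], which is
   the sum of the coefficients. *)
Definition topdeg a : Omega :=
  \big[Order.max / \bot%O]_(i <- dom a) i.

Definition positive a : bool := (a != 0) && (0 < coeff (topdeg a) a).

Definition t_ i : ordgroup := << i >>.

Lemma le_topdeg a i : coeff i a != 0 -> (i <= topdeg a)%O.
Proof. by rewrite -mem_dom => ia; apply: le_bigmax_seq. Qed.

Lemma coeff_gt_topdeg a i : (topdeg a < i)%O -> coeff i a = 0.
Proof.
by move=> ai; apply/eqP; apply: contraLR ai => /le_topdeg; rewrite -leNgt.
Qed.

Lemma coeff_topdeg a : a != 0 -> coeff (topdeg a) a != 0.
Proof.
rewrite -dom_eq0 -mem_dom /topdeg; elim: (dom a) => // i [|k s] IH _.
  by rewrite big_cons big_nil /Order.max ltx0 mem_head.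
rewrite big_cons /Order.max; case: ifP => _; last exact: mem_head.
by rewrite in_cons IH ?orbT.
Qed.

Lemma positiveP a : reflect
  (exists2 i, 0 < coeff i a & forall j, (i < j)%O -> coeff j a = 0) (positive a).
Proof.
apply: (iffP andP) => [[_ ca]|[i ci hi]].
  by exists (topdeg a) => // j; exact: coeff_gt_topdeg.
have a0 : a != 0 by apply: contraTneq ci => ->; rewrite coeff0 ltxx.
suff -> : topdeg a = i by [].
apply/le_anti; rewrite le_topdeg ?gt_eqF// andbT leNgt.
by apply/negP => /hi /eqP; exact/negP/coeff_topdeg.
Qed.

Lemma positive0 : positive 0 = false.
Proof. by rewrite /positive eqxx. Qed.

Lemma positiveD a b : positive a -> positive b -> positive (a + b).
Proof.
move=> /positiveP[i ci hi] /positiveP[j cj hj]; apply/positiveP; exists (Order.max i j).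
  rewrite coeffD; case: (ltgtP i j) => [ij|ji|ij].
  - by rewrite (hi _ ij) add0r.
  - by rewrite (hj _ ji) addr0.
  - by rewrite addr_gt0// ij.
by move=> k; rewrite gt_max => /andP[ik jk]; rewrite coeffD hi// hj.
Qed.

Lemma positive_total a : a != 0 -> positive a || positive (- a).
Proof.
move=> a0; have := coeff_topdeg a0; rewrite neq_lt => /orP[ca|ca].
  apply/orP; right; apply/positiveP; exists (topdeg a).
    by rewrite coeffN oppr_gt0.
  by move=> j /coeff_gt_topdeg; rewrite coeffN => ->; rewrite oppr0.
by apply/orP; left; apply/andP.
Qed.

Definition lt_ordgroup a b := positive (b - a).
Definition le_ordgroup a b := (a == b) || lt_ordgroup a b.

Fact lt_ordgroup_irr : irreflexive lt_ordgroup.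
Proof. by move=> a; rewrite /lt_ordgroup subrr positive0. Qed.

Fact lt_ordgroup_trans : transitive lt_ordgroup.
Proof.
by move=> b a c /positiveD ab /ab; rewrite addrC addrA subrK.
Qed.

HB.instance Definition _ := Order.LtLe_isPOrder.Build ring_display ordgroup
  (fun a b => erefl (le_ordgroup a b)) lt_ordgroup_irr lt_ordgroup_trans.

Fact le_ordgroup_total : total (<=%R : rel ordgroup).
Proof.
move=> a b; rewrite !le_eqVlt (eq_sym b); have [//|ab /=] := eqVneq a b.
have := @positive_total (b - a); rewrite subr_eq0 eq_sym opprB; exact.
Qed.

HB.instance Definition _ :=
  Order.POrder_isTotal.Build ring_display ordgroup le_ordgroup_total.

(* The element 1 = t_0. *)
Definition oneA : ordgroup := t_ \bot%O.

Lemma lt_ordgroupE a b : (a < b) = positive (b - a).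
Proof. by []. Qed.

Lemma ltA_add2r c a b : (a + c < b + c) = (a < b).
Proof. by rewrite !lt_ordgroupE opprD addrACA subrr addr0. Qed.

Lemma leA_add2r c a b : (a + c <= b + c) = (a <= b).
Proof. by rewrite !leNgt ltA_add2r. Qed.

Lemma leA_subr a b : (0 <= b - a) = (a <= b).
Proof. by rewrite -[LHS](leA_add2r a) add0r subrK. Qed.

Lemma leA_addr a b : (a <= a + b) = (0 <= b).
Proof. by rewrite -[RHS](leA_add2r a) add0r addrC. Qed.

Lemma addA_ge0 a b : 0 <= a -> 0 <= b -> 0 <= a + b.
Proof. by move=> a0 b0; apply: (le_trans a0); rewrite leA_addr. Qed.

Lemma oneA_gt0 : 0 < oneA.
Proof.
rewrite lt_ordgroupE subr0; apply/positiveP; exists \bot%O.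
  by rewrite coeffU eqxx.
by move=> j j0; rewrite coeffU lt_eqF// mulr0.
Qed.

(* 1 is the least positive element. *)
Lemma oneA_le a : (oneA <= a) = (0 < a).
Proof.
apply/idP/idP; first exact: lt_le_trans oneA_gt0.
rewrite [in X in X -> _]lt_ordgroupE subr0 => /positiveP[i ci hi].
have h j : coeff j (a - oneA) = coeff j a - (j == \bot%O)%:R.
  by rewrite coeffB coeffU mul1r eq_sym.
rewrite le_eqVlt eq_sym -subr_eq0 lt_ordgroupE.
have [//|a1 /=] := eqVneq (a - oneA) 0.
have [i0|i0] := eqVneq i \bot%O.
  have h0 j : (\bot < j)%O -> coeff j (a - oneA) = 0.
    by move=> j0; rewrite h hi ?i0// gt_eqF// subr0.
  apply/positiveP; exists \bot%O => //.
  rewrite lt_neqAle; apply/andP; split; last by rewrite h -i0 eqxx; lia.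
  apply: contra_neq a1 => e; apply/eqP/freeg_eqP => j; rewrite coeff0.
  by have [->|j0] := eqVneq j \bot%O; [rewrite -e|apply: h0; rewrite lt0x].
apply/positiveP; exists i => [|j ij]; first by rewrite h (negPf i0) subr0.
by rewrite h (hi _ ij) gt_eqF ?subr0//; apply: le_lt_trans ij; rewrite le0x.
Qed.

Lemma addA_oneA_le a b : (a + oneA <= b) = (a < b).
Proof.
rewrite -[LHS](leA_add2r (- a)) addrAC subrr add0r oneA_le.
by rewrite -[LHS](ltA_add2r a) add0r subrK.
Qed.

End OrderedGroup.


Section Words.
Context {disp : Order.disp_t} {Omega : bOrderType disp} {Gamma : Type}.
Local Notation A := (ordgroup Omega).
Local Notation oneA := (oneA Omega).

Definition Ainterval (l : A) : Type := {b : A | oneA <= b <= l}.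

Record word : Type := Word {
  wlen : A;
  wlen_ge0 : 0 <= wlen;
  wfun :> Ainterval wlen -> Gamma
}.

Implicit Types p q r : word.

(* Only used to state equality of words without casts along equal lengths. *)
Definition wget p (b : A) : option Gamma := omap p (insub b).

Lemma wgetE p (b : Ainterval (wlen p)) : wget p (val b) = Some (p b).
Proof. by rewrite /wget valK. Qed.

Lemma wget_out p b : ~~ (oneA <= b <= wlen p) -> wget p b = None.
Proof. by move=> h; rewrite /wget insubN. Qed.

Lemma word_eqP p q : p = q <-> wlen p = wlen q /\ wget p =1 wget q.
Proof.
split=> [->//|]; case: p q => [l l0 f] [m m0 g] /= [e]; subst m => fg.
have -> : l0 = m0 by exact: Prop_irrelevance.
congr Word; apply/funext => b; apply/Some_inj.
by have := fg (val b); rewrite (@wgetE (Word _ _)) (@wgetE (Word m0 g)).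
Qed.

Section Cat.
Variables p q : word.

Let itvl b : oneA <= b <= wlen p + wlen q -> b <= wlen p ->
  oneA <= b <= wlen p.
Proof. by case/andP => ->. Qed.

Let itvr b : oneA <= b <= wlen p + wlen q -> ~~ (b <= wlen p) ->
  oneA <= b - wlen p <= wlen q.
Proof.
move=> /andP[_ bl] bp; rewrite oneA_le -(ltA_add2r (wlen p)) add0r subrK.
by rewrite ltNge bp -(leA_add2r (wlen p)) subrK addrC.
Qed.

Definition wcat_fun (b : Ainterval (wlen p + wlen q)) : Gamma :=
  match boolP (val b <= wlen p) with
  | AltTrue bp => p (exist _ (val b) (itvl (valP b) bp))
  | AltFalse bp => q (exist _ (val b - wlen p) (itvr (valP b) bp))
  end.

Definition wcat : word := Word (addA_ge0 (wlen_ge0 p) (wlen_ge0 q)) wcat_fun.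

Lemma wget_cat b :
  wget wcat b = if b <= wlen p then wget p b else wget q (b - wlen p).
Proof.
have [h|h] := boolP (oneA <= b <= wlen wcat); last first.
  rewrite wget_out//; case: ifPn => bp; rewrite wget_out//; apply: contra h.
    by move=> /andP[-> _] /=; rewrite (le_trans bp)// leA_addr wlen_ge0.
  move=> /andP[b1 b2]; apply/andP; split.
    by rewrite oneA_le; move: bp; rewrite -ltNge; exact/le_lt_trans/wlen_ge0.
  by rewrite /= addrC -(leA_add2r (- wlen p)) addrK.
rewrite -[LHS]/(wget wcat (val (exist _ b h : Ainterval (wlen wcat)))) wgetE.
rewrite /= /wcat_fun /=; case: {-}_ / boolP => bp.
  by rewrite bp -wgetE.
by rewrite (negPf bp) -wgetE.
Qed.

End Cat.

Lemma Ainterval0 (b : Ainterval 0) : False.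
Proof.
by have /andP[b1 b0] := valP b; have := le_trans b1 b0; rewrite leNgt oneA_gt0.
Qed.

Definition wnil : word :=
  Word (lexx 0) (fun b => False_rect Gamma (Ainterval0 b)).

Lemma wget_nil b : wget wnil b = None.
Proof. by rewrite wget_out//; apply/negP => h; case: (@Ainterval0 (exist _ b h)). Qed.


Lemma wcat_nill : left_id wnil wcat.
Proof.
move=> p; apply/word_eqP; split=> [|b]; first exact: add0r.
rewrite wget_cat /= wget_nil subr0; case: ifPn => // b0.
by rewrite wget_out//; apply/negP => /andP[/le_trans/(_ b0)]; rewrite leNgt oneA_gt0.
Qed.

Lemma wcat_nilr : right_id wnil wcat.
Proof.
move=> p; apply/word_eqP; split=> [|b]; first exact: addr0.
rewrite wget_cat wget_nil; case: ifPn => // bp.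
by rewrite wget_out// (negPf bp) andbF.
Qed.

Lemma wcatA : associative wcat.
Proof.
move=> p q r; apply/word_eqP; split=> [|b]; first exact: addrA.
have e : (b - wlen p <= wlen q) = (b <= wlen p + wlen q).
  by rewrite -[LHS](leA_add2r (wlen p)) subrK addrC.
rewrite !wget_cat /= e opprD addrA; case: ifPn => bp; last by [].
by rewrite (le_trans bp)// leA_addr wlen_ge0.
Qed.

HB.instance Definition _ := gen_eqMixin word.
HB.instance Definition _ := gen_choiceMixin word.
HB.instance Definition _ := isMonoid.Build word wcatA wcat_nill wcat_nilr.

Definition wletter (a : Gamma) : word := Word (ltW (oneA_gt0 Omega)) (fun=> a).

(* The identification of Gamma^* with the finite words; see [finwordP]. *)
Definition finword (s : seq Gamma) : word := (\prod_(a <- s) wletter a)%g.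

Lemma wlen_finword s : wlen (finword s) = oneA *+ size s.
Proof.
rewrite /finword; elim: s => [|a s IH]; first by rewrite big_nil.
by rewrite big_cons /= IH mulrS.
Qed.

Lemma finwordP p :
  (exists n, wlen p = oneA *+ n) <-> (exists s, p = finword s).
Proof.
split=> [[n]|[s ->]]; last by exists (size s); rewrite wlen_finword.
elim: n p => [|n IH] p pn.
  exists [::]; rewrite /finword big_nil; apply/word_eqP; split=> // b.
  rewrite wget_nil wget_out// pn; apply/negP => /andP[b1 /(le_trans b1)].
  by rewrite leNgt oneA_gt0.
have n0 : 0 <= oneA *+ n.
  by elim: (n) => // k k0; rewrite mulrS addA_ge0// ltW// oneA_gt0.
have p1 : oneA <= oneA <= wlen p by rewrite lexx pn mulrS leA_addr.
have itv b : oneA <= b <= oneA *+ n -> oneA <= b + oneA <= wlen p.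
  move=> /andP[b1 bn]; rewrite pn mulrS [oneA + _]addrC leA_add2r bn andbT.
  by rewrite (le_trans b1)// leA_addr ltW// oneA_gt0.
pose q := Word n0 (fun b => p (exist _ (val b + oneA) (itv _ (valP b)))).
have [s qs] := IH q erefl.
exists (p (exist _ oneA p1) :: s); rewrite /finword big_cons -/(finword s) -qs.
apply/word_eqP; split=> [|b]; first by rewrite [LHS]pn mulrS.
rewrite wget_cat /=; case: ifPn => b1.
  have [->|bn1] := eqVneq b oneA.
    rewrite -[LHS]/(wget p (val (exist _ oneA p1 : Ainterval (wlen p)))) wgetE.
    have h : oneA <= oneA <= oneA by rewrite lexx.
    set a := p _; rewrite -[RHS]/(wget (wletter a)
      (val (exist _ oneA h : Ainterval (wlen (wletter a))))).
    by rewrite wgetE.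
  have nb : ~~ (oneA <= b) by rewrite -ltNge lt_neqAle bn1.
  by rewrite !wget_out// (negPf nb).
have [h|h] := boolP (oneA <= b - oneA <= oneA *+ n); last first.
  rewrite !wget_out//; apply: contra h => /andP[_ bn]; apply/andP; split.
    by rewrite oneA_le -(ltA_add2r oneA) add0r subrK ltNge.
  by rewrite -(leA_add2r oneA) subrK addrC -mulrS -pn.
rewrite -[RHS]/(wget q (val (exist _ (b - oneA) h : Ainterval (wlen q)))) wgetE.
have h' : oneA <= b <= wlen p by have := itv _ h; rewrite subrK.
rewrite -[LHS]/(wget p (val (exist _ b h' : Ainterval (wlen p)))) wgetE.
by congr (Some (p _)); apply: val_inj; rewrite /= subrK.
Qed.

Section Involution.
Variable bar : Gamma -> Gamma.

Let itv_bar l (b : A) : oneA <= b <= l -> oneA <= l + oneA - b <= l.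
Proof.
move=> /andP[b1 bl]; apply/andP; split.
  by rewrite -[X in is_true X](leA_add2r b) subrK addrC leA_add2r.
by rewrite -[X in is_true X](leA_add2r b) subrK addrC [l + b]addrC leA_add2r.
Qed.

Definition wbar (p : word) : word :=
  Word (wlen_ge0 p) (fun b =>
    bar (p (exist _ (wlen p + oneA - val b) (itv_bar (valP b))))).

Lemma wget_bar p b : wget (wbar p) b = omap bar (wget p (wlen p + oneA - b)).
Proof.
have [h|h] := boolP (oneA <= b <= wlen p); last first.
  rewrite !wget_out//; apply: contra h => /itv_bar.
  by rewrite opprB addrC subrK.
rewrite -[LHS]/(wget (wbar p) (val (exist _ b h : Ainterval (wlen p)))) wgetE.
set b' : Ainterval (wlen p) := exist _ (wlen p + oneA - b) (itv_bar h).
rewrite -[wget p _]/(wget p (val b')) wgetE.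
by congr (Some (bar (p _))); exact: val_inj.
Qed.

Lemma wbarK : involutive bar -> involutive wbar.
Proof.
move=> barK p; apply/word_eqP; split=> // b.
rewrite !wget_bar /= opprB addrC subrK.
by case: (wget p b) => //= a; rewrite barK.
Qed.

Lemma wbarM p q : wbar (p * q)%g = (wbar q * wbar p)%g.
Proof.
apply/word_eqP; split=> [|b]; first by rewrite /= addrC.
rewrite wget_bar !wget_cat !wget_bar /=.
set lp := wlen p; set lq := wlen q.
have -> : lp + lq + oneA - b - lp = lq + oneA - b.
  by rewrite -[lp + lq + _]addrA -[lp + _ - b]addrA [LHS]addrC addKr.
have -> : lp + oneA - (b - lq) = lp + lq + oneA - b.
  by rewrite opprB addrA [lp + oneA + lq]addrAC.
have -> : (lp + lq + oneA - b <= lp) = ~~ (b <= lq).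
  rewrite -ltNge -addA_oneA_le -[LHS](leA_add2r (b - lp)) [lp + (_ - _)]addrC subrK.
  by rewrite addrA subrK -!addrA addrC -!addrA addNr addr0.
by case: (b <= wlen q).
Qed.

End Involution.
End Words.

Arguments word {disp} Omega Gamma.

Section Extension.
Context {disp : Order.disp_t} (Omega : bOrderType disp).
Context {G : groupType} (Sigma : set G).
Local Open Scope group_scope.
Local Open Scope classical_set_scope.

Definition generates : Prop :=
  forall H : set G, Sigma `<=` H -> H 1 ->
    (forall x y, H x -> H y -> H (x * y)) -> (forall x, H x -> H x^-1) ->
    H = setT.

Definition Gamma : Type := {a : G | a \in Sigma `|` [set x^-1 | x in Sigma]}.

Let inv_Gamma (a : G) : a \in Sigma `|` [set x^-1 | x in Sigma] ->
  a^-1 \in Sigma `|` [set x^-1 | x in Sigma].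
Proof.
by rewrite !inE /= => -[aS|[x xS <-]]; [right; exists a|left; rewrite invgK].
Qed.

Definition bar (a : Gamma) : Gamma := exist _ (val a)^-1 (inv_Gamma (valP a)).

Lemma barK : involutive bar.
Proof. by move=> a; apply: val_inj; rewrite /= invgK. Qed.

Definition eval (w : seq Gamma) : G := \prod_(a <- w) val a.

Local Notation W := (word Omega Gamma).
Local Notation fin := (@finword _ Omega Gamma).
Local Notation wbar := (@wbar _ Omega Gamma bar).

(* x \in R(A, G) *)
Definition G_reduced (x : W) : Prop :=
  forall (p q : W) (f : seq Gamma),
    x = p * fin f * q -> eval f = 1 -> f = [::].

Lemma wbar1 : wbar 1 = 1.
Proof. by apply/word_eqP; split=> // b; rewrite wget_bar !wget_nil. Qed.

Lemma wbar_fin f : wbar (fin f) = fin (rev [seq bar a | a <- f]).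
Proof.
rewrite /finword; elim: f => [|a f IH]; first by rewrite !big_nil wbar1.
by rewrite map_cons rev_cons big_rcons big_cons wbarM IH.
Qed.

Lemma eval_bar f : eval (rev [seq bar a | a <- f]) = (eval f)^-1.
Proof.
rewrite /eval; elim: f => [|a f IH]; first by rewrite !big_nil invg1.
by rewrite map_cons rev_cons big_rcons big_cons invgM IH.
Qed.

Lemma reduced_bar x : G_reduced x -> G_reduced (wbar x).
Proof.
move=> xR p q f /(congr1 wbar).
rewrite (wbarK barK) !wbarM wbar_fin mulgA => /xR h f1.
have := h; rewrite eval_bar f1 invg1 => /(_ erefl)/(congr1 size)/=.
by rewrite size_rev size_map => /size0nil.
Qed.

(* R^*(A, G) *)
Inductive Rstar : W -> Prop :=
| Rstar_reduced u : G_reduced u -> Rstar u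
| Rstar1 : Rstar 1
| RstarM u v : Rstar u -> Rstar v -> Rstar (u * v).

(* The congruence on W(A, Gamma) generated by the defining relations. *)
Inductive Mcong : W -> W -> Prop :=
| Mcong_rel u l r : G_reduced u -> eval l = eval r ->
    Mcong (u * fin l * wbar (fin r) * wbar u) 1
| Mcong_refl x : Mcong x x
| Mcong_sym x y : Mcong x y -> Mcong y x
| Mcong_trans x y z : Mcong x y -> Mcong y z -> Mcong x z
| McongM x x' y y' : Mcong x x' -> Mcong y y' -> Mcong (x * y) (x' * y').

Definition Mcongb : rel W := fun x y => `[< Mcong x y >].

Let Mcongb_refl : reflexive Mcongb.
Proof. by move=> x; apply/asboolP; exact: Mcong_refl. Qed.
Let Mcongb_sym : symmetric Mcongb.
Proof. by move=> x y; apply/asboolP/asboolP; exact: Mcong_sym. Qed.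
Let Mcongb_trans : transitive Mcongb.
Proof.
by move=> y x z /asboolP xy /asboolP yz; apply/asboolP; exact: Mcong_trans yz.
Qed.

Canonical Mcong_equiv := EquivRel Mcongb Mcongb_refl Mcongb_sym Mcongb_trans.

Definition monoidM : Type := {eq_quot Mcong_equiv}%qT.
HB.instance Definition _ := Choice.on monoidM.
HB.instance Definition _ := EqQuotient.on monoidM.

Definition Mclass (w : W) : monoidM := \pi_(monoidM)%qT w.

Lemma Mclass_eqP (x y : W) : Mclass x = Mclass y <-> Mcong x y.
Proof.
have h : reflect (Mclass x = Mclass y) (Mcongb x y).
  exact: (@eqquotP _ Mcong_equiv monoidM x y).
split=> [e|xy]; last by apply/h/asboolP.
by apply/asboolP; apply/h.
Qed.

Lemma Mclass_surj (m : monoidM) : exists w, m = Mclass w.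
Proof. by exists (repr m); rewrite /Mclass reprK. Qed.

Definition monoidM_one : monoidM := Mclass 1.
Definition monoidM_mul (m n : monoidM) : monoidM := Mclass (repr m * repr n).

Let MmulE x y : monoidM_mul (Mclass x) (Mclass y) = Mclass (x * y).
Proof.
by apply/Mclass_eqP/McongM; apply/Mclass_eqP; rewrite /Mclass reprK.
Qed.

Let monoidM_mulA : associative monoidM_mul.
Proof.
move=> m n o; have [x ->] := Mclass_surj m; have [y ->] := Mclass_surj n.
by have [z ->] := Mclass_surj o; rewrite !MmulE mulgA.
Qed.
Let monoidM_mul1l : left_id monoidM_one monoidM_mul.
Proof. by move=> m; have [x ->] := Mclass_surj m; rewrite MmulE mul1g. Qed.
Let monoidM_mul1r : right_id monoidM_one monoidM_mul.
Proof. by move=> m; have [x ->] := Mclass_surj m; rewrite MmulE mulg1. Qed.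

HB.instance Definition _ :=
  isMonoid.Build monoidM monoidM_mulA monoidM_mul1l monoidM_mul1r.

Lemma MclassM x y : Mclass (x * y) = Mclass x * Mclass y.
Proof. exact/esym/MmulE. Qed.

Lemma Mclass1 : Mclass 1 = 1.
Proof. by []. Qed.

Definition groupE_set : pred monoidM := fun m => m \in Mclass @` Rstar.

Let Eclosed : monoid_closed groupE_set.
Proof.
split=> [|m n]; rewrite unfold_in /groupE_set !inE.
  by exists 1 => //; exact: Rstar1.
move=> [x xR <-] [y yR <-]; rewrite -MclassM.
by exists (x * y) => //; exact: RstarM.
Qed.

Definition groupE : Type := {m : monoidM | groupE_set m}.
HB.instance Definition _ := SubChoice.on groupE.
HB.instance Definition _ :=
  SubChoice_isSubMonoid.Build monoidM groupE_set groupE Eclosed.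

Lemma Mcong_bar x y : Mcong x y -> Mcong (wbar x) (wbar y).
Proof.
elim=> {x y} [u l r uR lr|x|x y _|x y z _ + _|x x' y y' _ xx _ yy].
- rewrite wbar1 !wbarM !(wbarK barK) !mulgA; exact: Mcong_rel.
- exact: Mcong_refl.
- exact: Mcong_sym.
- exact: Mcong_trans.
- by rewrite !wbarM; exact: McongM.
Qed.

Definition Minv (m : monoidM) : monoidM := Mclass (wbar (repr m)).

Lemma MinvE x : Minv (Mclass x) = Mclass (wbar x).
Proof.
by apply/Mclass_eqP/Mcong_bar/Mclass_eqP; rewrite /Mclass reprK.
Qed.

Lemma Mclass_barV u : G_reduced u -> Mclass u * Mclass (wbar u) = 1.
Proof.
move=> uR; rewrite -MclassM; apply/Mclass_eqP.
have := @Mcong_rel u [::] [::] uR erefl.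
by rewrite /finword big_nil wbar1 !mulg1.
Qed.

Lemma Mclass_Vbar u : G_reduced u -> Mclass (wbar u) * Mclass u = 1.
Proof. by move=> /reduced_bar/Mclass_barV; rewrite (wbarK barK). Qed.

Lemma Rstar_bar x : Rstar x -> Rstar (wbar x).
Proof.
elim=> {x} [u /reduced_bar|/=|u v _ uR _ vR]; first exact: Rstar_reduced.
  by rewrite wbar1; exact: Rstar1.
by rewrite wbarM; exact: RstarM.
Qed.

Let EsetV (m : monoidM) : groupE_set m -> groupE_set (Minv m).
Proof.
rewrite /groupE_set !inE => -[x xR <-]; rewrite MinvE.
by exists (wbar x) => //; exact: Rstar_bar.
Qed.

Lemma Rstar_inv x : Rstar x ->
  Mclass x * Mclass (wbar x) = 1 /\ Mclass (wbar x) * Mclass x = 1.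
Proof.
elim=> {x} [u uR||u v _ [u1 u2] _ [v1 v2]].
- by rewrite Mclass_barV// Mclass_Vbar.
- by rewrite wbar1 Mclass1 mulg1.
rewrite wbarM !MclassM !mulgA -[_ * Mclass (wbar v)]mulgA v1 mulg1 u1.
by rewrite -[_ * Mclass u]mulgA u2 mulg1 v2.
Qed.

Definition groupE_inv (e : groupE) : groupE :=
  exist _ (Minv (val e)) (EsetV (valP e)).

HB.instance Definition _ := hasInv.Build groupE groupE_inv.

Let EmulVg : left_inverse 1 groupE_inv *%g.
Proof.
move=> e; apply: val_inj; rewrite valM val1 /=; have := valP e.
by rewrite /groupE_set inE => -[x /Rstar_inv[_ ?] <-]; rewrite MinvE.
Qed.

Let EmulgV : right_inverse 1 groupE_inv *%g.
Proof.
move=> e; apply: val_inj; rewrite valM val1 /=; have := valP e.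
by rewrite /groupE_set inE => -[x /Rstar_inv[? _] <-]; rewrite MinvE.
Qed.

HB.instance Definition _ := Monoid_isGroup.Build groupE EmulVg EmulgV.

End Extension.

(* Main.v *)
Require Import Defs.
From HB Require Import structures.
From mathcomp Require Import ssreflect ssrfun ssrbool eqtype ssrnat seq choice.
From mathcomp Require Import monoid bigop generic_quotient order ssralg ssrnum.
From mathcomp Require Import boolp classical_sets.

(** Injectivity says that two finite words which are equal in M(A, G) have the
    same value in G.  The relations u l bar(r) bar(u) = 1 are split into two
    kinds: replacing a finite factor by another one with the same value (the
    case u = 1), and deleting a factor u bar(u) with u reduced (the case where
    l and r are empty).

    The first kind generates the congruence [fineq], whose quotient monoid is
    [wordG].  Finite words form a copy of G inside [wordG], because a word
    equivalent to a finite word is finite with the same value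
    ([fineq_fin_eval]).

    The second kind is viewed as a rewriting system p u u^-1 q -> p q on
    [wordG], where ^-1 denotes the involution and u ranges over the classes of
    reduced words.  It does not terminate, since the lengths lie in a positive
    cone that is not well founded, so local confluence would not suffice.
    It is however strongly confluent: two different one-step reducts of the
    same element are brought together by at most one further step on each side
    ([joins01_diamond]).  This depends only on four properties of [wordG]:
    Levi's property ([wordG_levi]), stability of the reduced elements under
    factors and involution, the fact that u u^-1 is reduced only if it is
    trivial ([reducedG_pal]), and the fact that reduced elements can be
    cancelled on the left ([reducedG_lcancel]).  The last two are where the
    definition of a reduced word enters.

    By confluence, elements that are equal in M(A, G) have a common reduct.
    But every factor of the class of a finite word is again the class of a
    finite word, hence a unit whose inverse is its involute, so that a rewriting
    step starting from it changes nothing ([gcls_irreducible]).  Thus finite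
    words equal in M(A, G) are already equal in [wordG], that is, in G. *)

Set Implicit Arguments.
Unset Strict Implicit.
Unset Printing Implicit Defensive.

Import Order.TTheory GRing.Theory Num.Theory.

Local Open Scope group_scope.

(** * Strong confluence of the deletion of trivial palindromes *)

(** The cuts of a word are linearly ordered: of two factorizations of the same
    element, one refines the other. *)
Definition levi_prop (M : monoidType) : Prop :=
  forall x y z t : M, x * y = z * t ->
  exists m, (x = z * m /\ t = m * y) \/ (z = x * m /\ y = m * t).

(** In this part x^-1 is only the image of x under the involution: x * x^-1 need
    not be 1. *)
Section Confluence.
Context {M : starMonoidType} (R : M -> Prop).

(* R stands for the set of reduced elements. *)
Context (leviM : levi_prop M).
Context (R_factorl : forall x y, R (x * y) -> R x).
Context (R_star : forall x, R x -> R x^-1).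
Context (R_pal : forall x, R (x * x^-1) -> x * x^-1 = 1).
Context (R_lcancel : forall u x y, R u -> u * x = u * y -> x = y).

Inductive cancels : M -> M -> Prop :=
| Cancels p u q : R u -> cancels (p * u * u^-1 * q) (p * q).

Inductive reduces : M -> M -> Prop :=
| reduces_refl x : reduces x x
| reduces_cons x y z : cancels x y -> reduces y z -> reduces x z.

(** The suffix 01 stands for at most one step. *)
Definition cancels01 x y := x = y \/ cancels x y.

Definition joins01 x y := exists z, cancels01 x z /\ cancels01 y z.

Lemma joins01_sym x y : joins01 x y -> joins01 y x.
Proof. by move=> [z [? ?]]; exists z. Qed.

Lemma joins01_cancels x y : cancels x y -> joins01 x y.
Proof. by move=> xy; exists y; split; [right|left]. Qed.

Lemma cancelsP p u q x y : R u -> x = p * u * u^-1 * q -> y = p * q ->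
  cancels x y.
Proof. by move=> uR -> ->; constructor. Qed.

Lemma R_factorr x y : R (x * y) -> R y.
Proof. by move=> /R_star; rewrite invgM => /R_factorl/R_star; rewrite invgK. Qed.

Lemma R_factor x y z : R (x * y * z) -> R y.
Proof. by move=> /R_factorl/R_factorr. Qed.

Lemma R_sub x y w z : R z -> z = x * y * w -> R y.
Proof. by move=> zR e; apply: (@R_factor x y w); rewrite -e. Qed.

Lemma R_palV x : R (x^-1 * x) -> x^-1 * x = 1.
Proof. by move=> h; have := @R_pal x^-1; rewrite invgK; apply. Qed.

(** The two deleted factors have the same centre, so one of the arms is a suffix
    of the other, say u = e * v.  Deleting the longer palindrome amounts to
    deleting v v^-1 and then e e^-1; to see that the right-hand contexts match,
    the arm v^-1 has to be cancelled on the left, which is legitimate because it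
    is reduced. *)
Lemma joins01_same p u q p' v q' : R u -> R v ->
  p * u = p' * v -> u^-1 * q = v^-1 * q' -> joins01 (p * q) (p' * q').
Proof.
wlog: p u q p' v q' / exists e, p' = p * e /\ u = e * v.
  move=> wl uR vR e1 e2; have [e [[e3 e4]|[e3 e4]]] := leviM e1.
    by apply: joins01_sym; apply: wl vR uR _ _ => //; exists e.
  by apply: wl uR vR _ _ => //; exists e.
move=> [e [-> ->]] uR vR _; rewrite invgM -mulgA => /R_lcancel <-; last exact: R_star.
apply/joins01_sym/joins01_cancels.
by apply: (cancelsP (p := p) (q := q) (R_factorl uR)); rewrite ?mulgA.
Qed.

Ltac assoc := rewrite ?invgM ?invgK ?mulgA ?mul1g ?mulg1.

(** The centre of u u^-1 lies inside the second arm k u n of v v^-1, and u does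
    not reach back over the centre of v v^-1.  Since v is reduced, the part of
    u^-1 that overlaps n must be trivial, so the two deletions remove the same
    letters up to one smaller palindrome k^-1 k. *)
Lemma joins01_nested p' n u k q q' : R (k * u * n) -> u^-1 * q = n * q' ->
  joins01 (p' * n^-1 * u^-1 * k^-1 * k * q) (p' * q').
Proof.
move=> vR e.
have kR : R k^-1 by apply: R_star; apply: (R_sub (x := 1) (w := u * n) vR); assoc.
have [j [[e1 e2]|[e1 e2]]] := leviM e; last first.
  have u1 : u * u^-1 = 1.
    by apply: R_pal; apply: (R_sub (x := k) (w := j) vR); rewrite e1; assoc.
  apply/joins01_cancels/(cancelsP (p := p') (q := q') (R_star vR)) => //.
  transitivity (p' * n^-1 * u^-1 * k^-1 * k * (u * (n * q'))); last by assoc.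
  by rewrite -e (mulgA u) u1 mul1g.
have n1 : n^-1 * n = 1.
  apply: R_palV; apply: (R_sub (x := k * j^-1) (w := 1) vR).
  by rewrite -(invgK u) e1; assoc.
have -> : p' * n^-1 * u^-1 * k^-1 * k * q = p' * j * k^-1 * k * q.
  by rewrite e1 mulgA -(mulgA p') n1 mulg1.
rewrite e2 mulgA; apply/joins01_cancels/(cancelsP (p := p' * j) (q := q) kR) => //.
by rewrite invgK.
Qed.

(** The centre of u u^-1 lies in the second arm v^-1 = m n of v v^-1, at the end
    of m.  If u reaches back over the centre of v v^-1, it contains a palindrome
    around that centre, which is trivial because u is reduced; hence, up to
    trivial factors, either the two centres coincide or u is a suffix of m. *)
Lemma joins01_diamond_inner p u q p' v q' m n : R u -> R v ->
  p * u = p' * v * m -> v^-1 = m * n -> u^-1 * q = n * q' ->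
  joins01 (p * q) (p' * q').
Proof.
move=> uR vR e1 ev e2.
have {}ev : v = n^-1 * m^-1 by rewrite -invgM -ev invgK.
rewrite {v}ev in vR e1.
have vR' : R (m * n) by move: (R_star vR); assoc.
have [k [[e3 e4]|[e3 e4]]] := leviM e1.
  move: e3 e4; assoc => -> e4; rewrite e4 in vR'.
  have := joins01_nested p' vR' e2; rewrite e4.
  by assoc.
have {}e3 : p' * n^-1 * m^-1 = p * k by rewrite -e3; assoc.
have [j [[e5 e6]|[e5 e6]]] := leviM e3.
  have m1 : m^-1 * m = 1.
    by apply: R_palV; apply: (R_sub (x := j) (w := 1) uR); rewrite e4 e6; assoc.
  have uj : u = j by rewrite e4 e6 -mulgA m1 mulg1.
  apply: (@joins01_same p u q p' n^-1 q') => //.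
  - by apply: (R_sub (x := 1) (w := m^-1) vR); assoc.
  - by rewrite uj -e5.
  - by rewrite invgK.
have k1 : k * k^-1 = 1.
  apply: R_pal; apply: (R_sub (x := 1) (w := j^-1) uR).
  by rewrite e4 -(invgK m) e6; assoc.
have mu : m = k^-1 * u.
  by rewrite e4 -(invgK m) e6; assoc; rewrite -(mulgA k^-1) k1 mulg1.
rewrite mu in vR'.
have := joins01_nested p' vR' e2; rewrite invgK.
have -> // : p' * n^-1 * u^-1 * k * k^-1 * q = p * q.
rewrite -(mulgA _ k) k1 mulg1 e5 e4.
by rewrite -(invgK m) e6; assoc; rewrite -(mulgA _ k k^-1) k1 mulg1.
Qed.

(** The centre of u u^-1 lies to the right of v v^-1.  Either u is disjoint from
    v v^-1, or it overlaps the second arm only, or it contains all of v^-1 and a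
    final part of v, which is then trivial because u is reduced. *)
Lemma joins01_diamond_left p u q p' v q' k : R u -> R v ->
  p * u = p' * v * v^-1 * k -> q' = k * u^-1 * q -> joins01 (p * q) (p' * q').
Proof.
move=> uR vR e ->.
have : p * u = p' * v * (v^-1 * k) by rewrite e; assoc.
move=> /leviM[n [[-> {}e]|[e' eu]]].
  have {e} [l [[ev eu]|[-> ->]]] := leviM e.
    have {}ev : v = l^-1 * n^-1 by rewrite -invgM -ev invgK.
    exists (p' * l^-1 * q); split; right.
      have nR : R n^-1.
        by apply: (R_sub (x := l^-1) (w := 1) vR); rewrite ev; assoc.
      by apply: (cancelsP (p := p' * l^-1) (q := q) nR); rewrite ?ev; assoc.
    have kR : R k.
      by apply: (R_sub (x := l) (w := 1) uR); rewrite eu; assoc.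
    by apply: (cancelsP (p := p') (q := l^-1 * q) kR); rewrite ?eu; assoc.
  exists (p' * l * q); split; right.
    by apply: (cancelsP (p := p') (q := l * q) vR); assoc.
  by apply: (cancelsP (p := p' * l) (q := q) uR); assoc.
have [l [[ep en]|[-> ev]]] := leviM e'.
  have v1 : v * v^-1 = 1.
    by apply: R_pal; apply: (R_sub (x := l) (w := k) uR); rewrite eu en; assoc.
  apply/joins01_sym/joins01_cancels/(cancelsP (p := p) (q := q) uR) => //.
  rewrite e; transitivity (p' * (v * v^-1) * k * u^-1 * q); last by assoc.
  by rewrite v1; assoc.
have n1 : n * n^-1 = 1.
  by apply: R_pal; apply: (R_sub (x := 1) (w := l^-1 * k) uR); rewrite eu ev; assoc.
have {}eu : u = l^-1 * k by rewrite eu ev; assoc; rewrite n1; assoc.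
have kR : R k by apply: (R_sub (x := l^-1) (w := 1) uR); rewrite eu; assoc.
apply/joins01_sym/joins01_cancels/(cancelsP (p := p') (q := l * q) kR).
  by rewrite eu; assoc.
by assoc.
Qed.

(** Comparing the two centres leaves, up to exchanging the roles of u and v, the
    two preceding situations. *)
Lemma joins01_diamond x y z : cancels x y -> cancels x z -> joins01 y z.
Proof.
move=> xy xz; move: xy xz => [p u q uR].
move: {-1}(_ * q) (erefl (p * u * u^-1 * q)) => w ew wz.
case: wz ew => p' v q' vR e {w}.
wlog: p u q p' v q' uR vR e / exists2 m, p * u = p' * v * m & v^-1 * q' = m * (u^-1 * q).
  move=> wl; have e' : (p * u) * (u^-1 * q) = (p' * v) * (v^-1 * q').
    by move: e; assoc.
  have [m [[e1 e2]|[e1 e2]]] := leviM e'.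
    by apply: wl uR vR _ _ => //; exists m.
  by apply: joins01_sym; apply: wl vR uR _ _ => //; exists m.
move=> [m e1 /leviM[k [[ev e2]|[em ->]]]].
  exact: joins01_diamond_inner uR vR e1 ev e2.
by apply: (joins01_diamond_left uR vR (k := k)); rewrite ?e1 ?em; assoc.
Qed.

Lemma reduces_trans y x z : reduces x y -> reduces y z -> reduces x z.
Proof. by elim=> // {}x x' {}y xx' _ IH /IH; exact: reduces_cons. Qed.

Lemma reduces01 x y : cancels01 x y -> reduces x y.
Proof.
by case=> [->|xy]; [|apply: reduces_cons xy _]; exact: reduces_refl.
Qed.

(** Because the diamond closes with at most one step on each side, a single step
    can be pushed along a reduction of any length without any appeal to
    termination. *)
Lemma reduces_strip x y z : reduces x z -> cancels x y ->
  exists2 w, reduces y w & cancels01 z w.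
Proof.
move=> xz; elim: xz y => {x z} [x|x x1 z xx1 x1z IH] y xy.
  by exists y; [exact: reduces_refl|right].
have [t [yt [x1t|x1t]]] := joins01_diamond xy xx1.
  rewrite x1t in x1z; exists z; last by left.
  by apply: reduces_trans x1z; exact: reduces01.
have [w tw zw] := IH _ x1t.
by exists w => //; apply: reduces_trans tw; exact: reduces01.
Qed.

Lemma reduces_confluent x y z : reduces x y -> reduces x z ->
  exists2 w, reduces y w & reduces z w.
Proof.
move=> xy; elim: xy z => {x y} [x|x x1 y xx1 _ IH] z xz.
  by exists z => //; exact: reduces_refl.
have [w x1w zw] := reduces_strip xz xx1.
have [t yt wt] := IH _ x1w.
by exists t => //; apply: reduces_trans wt; exact: reduces01.
Qed.

Lemma reducesM x x' y y' : reduces x x' -> reduces y y' -> reduces (x * y) (x' * y').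
Proof.
move=> xx yy; apply: (@reduces_trans (x' * y)).
  elim: xx => [z|z z1 z' [p u q uR] _ IH]; first exact: reduces_refl.
  apply: reduces_cons IH.
  by apply: (cancelsP (p := p) (q := q * y) uR); assoc.
elim: yy => [z|z z1 z' [p u q uR] _ IH]; first exact: reduces_refl.
apply: reduces_cons IH.
by apply: (cancelsP (p := x' * p) (q := q) uR); assoc.
Qed.

(** By confluence this is the congruence generated by [cancels]. *)
Definition joinable x y := exists2 z, reduces x z & reduces y z.

Lemma joinable_refl x : joinable x x.
Proof. by exists x; exact: reduces_refl. Qed.

Lemma joinable_sym x y : joinable x y -> joinable y x.
Proof. by case=> z ? ?; exists z. Qed.

Lemma joinable_trans y x z : joinable x y -> joinable y z -> joinable x z.
Proof.
move=> [s xs ys] [t yt zt]; have [w sw tw] := reduces_confluent ys yt.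
by exists w; [exact: reduces_trans xs sw|exact: reduces_trans zt tw].
Qed.

Lemma joinableM x x' y y' : joinable x x' -> joinable y y' ->
  joinable (x * y) (x' * y').
Proof. by move=> [s ? ?] [t ? ?]; exists (s * t); exact: reducesM. Qed.

End Confluence.

(** * Factorizations of words *)

Section WordFactors.
Context {disp : Order.disp_t} {Omega : bOrderType disp} {T : Type}.
Local Notation W := (word Omega T).
Local Notation oneA := (oneA Omega).
Implicit Types (p q r s x y : W) (f g : seq T).

Lemma wlenM p q : wlen (p * q) = (wlen p + wlen q)%R.
Proof. by []. Qed.

Lemma wgetM p q b : wget (p * q) b =
  if (b <= wlen p)%O then wget p b else wget q (b - wlen p)%R.
Proof. exact: wget_cat. Qed.

Lemma wlen_eq0 p : wlen p = 0%R -> p = 1.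
Proof.
move=> p0; apply/word_eqP; split=> // b; rewrite [RHS]wget_nil wget_out// p0.
by apply/negP => /andP[/le_trans h /h]; rewrite leNgt oneA_gt0.
Qed.

(** Concatenation determines its factors once the length of the first is known;
    Levi's property and cancellation both follow from this. *)
Lemma wmul_inj p q r s : wlen p = wlen r -> p * q = r * s -> p = r /\ q = s.
Proof.
move=> e pq; have eg b : wget (p * q) b = wget (r * s) b by rewrite pq.
have el : (wlen p + wlen q = wlen r + wlen s)%R by rewrite -!wlenM pq.
split; apply/word_eqP; split=> //.
- move=> b; have := eg b; rewrite !wgetM e; case: ifPn => // h _.
  by rewrite !wget_out// ?e negb_and h orbT.
- by move: el; rewrite e => /addrI.
- move=> b; have := eg (b + wlen p)%R; rewrite !wgetM e addrK.
  case: ifPn => // h _; have b0 : (b <= 0)%R.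
    by rewrite -(leA_add2r (wlen r)) add0r.
  rewrite !wget_out//; apply/negP => /andP[/le_trans/(_ b0)];
    by rewrite leNgt oneA_gt0.
Qed.

Lemma wmulgI p q s : p * q = p * s -> q = s.
Proof. by case/wmul_inj. Qed.

Lemma wsplit x (a : ordgroup Omega) : (0 <= a)%R -> (a <= wlen x)%O ->
  exists p q, x = p * q /\ wlen p = a.
Proof.
move=> a0 ax.
have hp b : (oneA <= b <= a)%O -> (oneA <= b <= wlen x)%O.
  by move=> /andP[-> /le_trans]; exact.
have hq b : (oneA <= b <= wlen x - a)%R -> (oneA <= b + a <= wlen x)%R.
  move=> /andP[b1 bx]; rewrite (le_trans b1) ?leA_addr//=.
  by rewrite -[wlen x](subrK a) leA_add2r.
have d0 : (0 <= wlen x - a)%R by rewrite leA_subr.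
pose p := Word a0 (fun b => x (exist _ (val b) (hp _ (valP b)))).
pose q := Word d0 (fun b => x (exist _ (val b + a)%R (hq _ (valP b)))).
exists p, q; split=> //; apply/word_eqP; split=> [|b].
  by rewrite wlenM /= addrC subrK.
have gp c : (oneA <= c <= a)%O -> wget p c = wget x c.
  move=> h; rewrite -[LHS]/(wget p (val (exist _ c h : Ainterval (wlen p)))) wgetE.
  rewrite -[RHS]/(wget x (val (exist _ c (hp _ h) : Ainterval (wlen x)))) wgetE.
  by congr (Some (x _)); exact: val_inj.
have gq c : (oneA <= c <= wlen x - a)%R -> wget q c = wget x (c + a)%R.
  move=> h; rewrite -[LHS]/(wget q (val (exist _ c h : Ainterval (wlen q)))) wgetE.
  rewrite -[RHS]/(wget x (val (exist _ (c + a)%R (hq _ h) : Ainterval (wlen x)))) wgetE.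
  by congr (Some (x _)); exact: val_inj.
rewrite wgetM /=; case: ifPn => ba.
  have [b1|b1] := boolP (oneA <= b)%O; first by rewrite gp ?b1.
  by rewrite !wget_out ?(negPf b1).
have b1 : (oneA <= b - a)%R.
  by rewrite oneA_le -(ltA_add2r a) add0r subrK ltNge.
have [bx|bx] := boolP (b <= wlen x)%O.
  by rewrite gq ?subrK// b1 leA_add2r.
by rewrite !wget_out//= ?leA_add2r (negPf bx) andbF.
Qed.

Lemma word_levi : levi_prop W.
Proof.
suff h p q r s : (wlen p <= wlen r)%O -> p * q = r * s ->
    exists m, r = p * m /\ q = m * s.
  move=> p q r s e; case: (leP (wlen p) (wlen r)) => [l|/ltW l].
    by have [m [? ?]] := h _ _ _ _ l e; exists m; right.
  by have [m [? ?]] := h _ _ _ _ l (esym e); exists m; left.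
move=> l e; have [p' [m [rE lp]]] := wsplit (wlen_ge0 p) l.
move: e; rewrite rE -mulgA => /(wmul_inj (esym lp))[-> ->].
by exists m.
Qed.

Lemma finword_nil : finword [::] = 1 :> W.
Proof. by rewrite /finword big_nil. Qed.

Lemma finword_cons a f : finword (a :: f) = wletter a * finword f :> W.
Proof. by rewrite /finword big_cons. Qed.

Lemma finword_cat f g : finword (f ++ g) = finword f * finword g :> W.
Proof. by rewrite /finword big_cat. Qed.

Lemma wletter_inj a b x y : wletter a * x = wletter b * y :> W -> a = b /\ x = y.
Proof.
move=> /wmul_inj[]// ab ->; split=> //.
have h : (oneA <= oneA <= oneA)%O by rewrite lexx.
have := congr1 (fun w => wget w oneA) ab.
have ev c : wget (wletter c : W) oneA = Some c.
  by rewrite -[LHS]/(wget (wletter c)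
    (val (exist _ oneA h : Ainterval (wlen (wletter c : W))))) wgetE.
by rewrite !ev => -[].
Qed.

(** The order on A is discrete, so a word of positive length has a first letter,
    however long it is. *)
Lemma word_cases x : x = 1 \/ exists a y, x = wletter a * y.
Proof.
have [x0|x0] := eqVneq (wlen x) 0%R; [by left; exact: wlen_eq0|right].
have : (oneA <= wlen x)%O by rewrite oneA_le lt_neqAle eq_sym x0 wlen_ge0.
move=> /(wsplit (ltW (oneA_gt0 Omega)))[p [q [xE lp]]].
have [|s ps] := (finwordP p).1; first by exists 1%N; rewrite lp mulr1n.
case: s ps => [|a s] ps.
  by move: lp; rewrite ps finword_nil => h; have := oneA_gt0 Omega; rewrite -h ltxx.
by exists a, (finword s * q); rewrite xE ps finword_cons mulgA.
Qed.

Lemma wletter_neq1 a x : wletter a * x <> 1 :> W.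
Proof.
move=> /(congr1 (@wlen _ _ _)); rewrite wlenM /= => h.
have : (0 < oneA + wlen x)%R.
  by apply: lt_le_trans (oneA_gt0 Omega) _; rewrite leA_addr wlen_ge0.
by rewrite h ltxx.
Qed.

Lemma finword_factor f p q : finword f = p * q ->
  exists f1 f2, [/\ f = f1 ++ f2, p = finword f1 & q = finword f2].
Proof.
elim: f p => [|a f IH] p e.
  move: e; case: (word_cases p) => [->|[b [p' ->]]]; last first.
    by rewrite finword_nil -mulgA => /esym/wletter_neq1.
  by rewrite mul1g => <-; exists [::], [::]; rewrite finword_nil.
case: (word_cases p) e => [->|[b [p' ->]]].
  by rewrite mul1g => <-; exists [::], (a :: f); rewrite finword_nil.
rewrite finword_cons -mulgA => /wletter_inj[-> /IH[f1 [f2 [-> -> ->]]]].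
by exists (b :: f1), f2; rewrite finword_cons.
Qed.

Lemma finword_inj : injective (@finword _ Omega T).
Proof.
elim=> [|a f IH] [|b g] //; rewrite ?finword_nil ?finword_cons.
- by move=> /esym/wletter_neq1.
- by move=> /wletter_neq1.
- by move=> /wletter_inj[-> /IH ->].
Qed.

(** Levi's property against a finite prefix, with the middle factor resolved as
    a finite word whenever it has to be one. *)
Lemma finword_levi r y f q : r * y = finword f * q ->
  (exists2 m, r = finword f * m & q = m * y) \/
  (exists f1 f2, [/\ f = f1 ++ f2, r = finword f1 & y = finword f2 * q]).
Proof.
move=> /word_levi[m [[-> ->]|[e ->]]]; first by left; exists m.
have [f1 [f2 [-> -> ->]]] := finword_factor e.
by right; exists f1, f2.
Qed.

End WordFactors.

(** * Replacement of finite factors *)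

Section FiniteReplacement.
Context {disp : Order.disp_t} {Omega : bOrderType disp}.
Context {G : groupType} {Sigma : set G}.
Local Notation W := (word Omega (Gamma Sigma)).
Local Notation fin := (@finword _ Omega (Gamma Sigma)).
Local Notation wbar := (@wbar _ Omega (Gamma Sigma) (@bar _ Sigma)).
Local Notation G_reduced := (@G_reduced _ Omega _ Sigma).
Local Notation finv f := (rev [seq bar a | a <- f]).
Implicit Types (p q r s x y z u v : W) (f g h : seq (Gamma Sigma)).

Lemma eval_cat f g : eval (f ++ g) = eval f * eval g.
Proof. by rewrite /eval big_cat. Qed.

Lemma eval_nil : eval ([::] : seq (Gamma Sigma)) = 1.
Proof. by rewrite /eval big_nil. Qed.

Lemma eval_finv f : eval f * eval (finv f) = 1.
Proof. by rewrite eval_bar mulgV. Qed.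

Lemma mulg_eq1C (a b : G) : a * b = 1 -> b * a = 1.
Proof. by move=> ab; rewrite -(mulKg a b) ab mulg1 mulVg. Qed.

(** Two words are related when they are aligned by finitely many blocks that are
    either equal words or finite words with the same value.  Transitivity is not
    built in: an alignment can then be read from left to right, which is how all
    the properties below are proved. *)
Inductive fineq : W -> W -> Prop :=
| fineq1 : fineq 1 1
| fineq_same p x y : fineq x y -> fineq (p * x) (p * y)
| fineq_fin f g x y : eval f = eval g -> fineq x y ->
    fineq (fin f * x) (fin g * y).

Lemma fineq_refl x : fineq x x.
Proof. by rewrite -(mulg1 x); apply: fineq_same; exact: fineq1. Qed.

Lemma fineq_sym x y : fineq x y -> fineq y x.
Proof.
elim=> {x y} [|p x y _ IH|f g x y e _ IH]; first exact: fineq1.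
  exact: fineq_same.
exact: fineq_fin.
Qed.

Lemma fineqM x x' y y' : fineq x x' -> fineq y y' -> fineq (x * y) (x' * y').
Proof.
move=> xx yy; elim: xx => {x x'} [|p x x' _ IH|f g x x' e _ IH].
- by rewrite !mul1g.
- by rewrite -!mulgA; exact: fineq_same.
- by rewrite -!mulgA; exact: fineq_fin.
Qed.

Lemma fin_fineq f g : eval f = eval g -> fineq (fin f) (fin g).
Proof.
by move=> e; rewrite -[fin f]mulg1 -[fin g]mulg1; apply: fineq_fin (fineq1).
Qed.

Lemma word1_factor x y : x * y = 1 :> W -> x = 1 /\ y = 1.
Proof.
rewrite -finword_nil => /esym/finword_factor[f1 [f2 [e -> ->]]].
by case: f1 f2 e => [|//] [].
Qed.

(** An alignment absorbs finite factors at its left end.  This is what is needed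
    when a finite factor of one word is cut by a block boundary: the piece after
    the boundary is compensated by the piece before it. *)
Lemma fineq_head x z f q f1 f' : fineq x z -> z = fin f * q ->
  eval f1 * eval f = eval f' -> fineq (fin f1 * x) (fin f' * q).
Proof.
move=> xz; elim: xz f q f1 f' => {x z} [|r x y xy IH|g g' x y eg xy IH] f q f1 f' e ef.
- have [f0 ->] := word1_factor (esym e).
  have {}f0 : f = [::] by apply: (@finword_inj _ Omega); rewrite f0 finword_nil.
  by rewrite f0 eval_nil mulg1 in ef; exact: fineqM (fin_fineq ef) fineq1.
- case: (finword_levi e) => [[m -> ->]|[g1 [g2 [fE -> ey]]]].
    rewrite !mulgA -finword_cat -!mulgA.
    by apply: fineq_fin; [rewrite eval_cat|exact: fineq_same].
  rewrite mulgA -finword_cat; apply: IH ey _.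
  by rewrite -ef fE !eval_cat mulgA.
- case: (finword_levi e) => [[m g'E ->]|[g1 [g2 [fE /finword_inj g'E ey]]]].
    have [h1 [h2 [g'E' /finword_inj h1E mE]]] := finword_factor g'E.
    rewrite mE !mulgA -!finword_cat; apply: fineq_fin xy.
    by rewrite !eval_cat eg g'E' -h1E eval_cat -ef mulgA.
  rewrite mulgA -finword_cat; apply: IH ey _.
  by rewrite -ef fE !eval_cat eg g'E mulgA.
Qed.

(** One finite replacement in the second word; transitivity follows by making
    the replacements of the second alignment one after another. *)
Lemma fineq_replace x z p f q f' : fineq x z -> z = p * fin f * q ->
  eval f = eval f' -> fineq x (p * fin f' * q).
Proof.
move=> xz; elim: xz p f q f' => {x z} [|r x y xy IH|g g' x y eg xy IH] p f q f' e ef.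
- have [/word1_factor[-> f0] ->] := word1_factor (esym e).
  rewrite mul1g mulg1 -finword_nil; apply: fin_fineq.
  by rewrite -ef; congr eval; apply/esym/(@finword_inj _ Omega); rewrite f0 finword_nil.
- rewrite -!mulgA in e *; case: (word_levi e) => [m [[-> ey]|[-> ey]]].
    case: (finword_levi (esym ey)) => [[n -> ->]|[g1 [g2 [fE -> ey']]]].
      rewrite -!mulgA; apply: fineq_same; apply: fineq_fin => //; exact: fineq_same.
    rewrite -mulgA; apply: fineq_same; apply: fineq_head xy ey' _.
    by rewrite -eval_cat -fE.
  by rewrite -mulgA; apply: fineq_same; rewrite mulgA; apply: IH ef; rewrite -mulgA.
- rewrite -!mulgA in e *; case: (word_levi e) => [m [[g'E ey]|[-> ey]]].
    have [h1 [h2 [g'E' -> mE]]] := finword_factor g'E.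
    move: ey g'E' eg; rewrite {}mE => ey {g'E}-> eg.
    case: (finword_levi (esym ey)) => [[n n1 ->]|[g1 [g2 [fE /finword_inj h2E ey']]]].
      have [k1 [k2 [h2E /finword_inj fE ->]]] := finword_factor n1.
      rewrite !mulgA -!finword_cat; apply: fineq_fin xy.
      by rewrite eg h2E -fE !eval_cat ef mulgA.
    rewrite mulgA -finword_cat; apply: fineq_head xy ey' _.
    by rewrite eg h2E !eval_cat -ef fE eval_cat mulgA.
  by rewrite -mulgA; apply: fineq_fin => //; rewrite mulgA; apply: IH ef; rewrite -mulgA.
Qed.

Lemma fineq_trans y x z : fineq x y -> fineq y z -> fineq x z.
Proof.
move=> xy yz; rewrite -(mul1g z); rewrite -(mul1g y) in xy.
elim: yz 1 xy => {y z} // [r y z _ IH|f g y z e _ IH] p xy.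
  by rewrite mulgA; apply: IH; rewrite -mulgA.
by rewrite mulgA; apply: fineq_replace e => //; apply: IH; rewrite -mulgA.
Qed.

Lemma fineq_bar x y : fineq x y -> fineq (wbar x) (wbar y).
Proof.
elim=> {x y} [|p x y _ IH|f g x y e _ IH]; first exact: fineq_refl.
  by rewrite !wbarM; apply: fineqM IH (fineq_refl _).
rewrite !wbarM !wbar_fin; apply: fineqM IH _.
by apply: fin_fineq; rewrite !eval_bar e.
Qed.

(** A cut of a word survives finite replacements, up to a finite correction f on
    both sides.  The correction is needed when the cut falls inside a replaced
    factor. *)
Lemma fineq_split x y w : fineq (x * y) w ->
  exists x' y' f, [/\ w = x' * y', fineq x (x' * fin f) & fineq (fin f * y) y'].
Proof.
move ez: (x * y) => z zw.
elim: zw x y ez => {z w} [|p z w zw IH|f g z w e zw IH] x y ez.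
- have [-> ->] := word1_factor ez.
  exists 1, 1, [::]; rewrite finword_nil !mulg1; split=> //; exact: fineq1.
- case: (word_levi ez) => [m [[-> ey]|[-> ->]]].
    have [x' [y' [f [-> mx ty]]]] := IH _ _ (esym ey).
    exists (p * x'), y', f; split=> //; first by rewrite mulgA.
    by rewrite -mulgA; exact: fineq_same.
  exists x, (m * w), [::]; rewrite finword_nil mul1g mulg1 mulgA; split=> //.
    exact: fineq_refl.
  exact: fineq_same.
- case: (finword_levi ez) => [[m -> ey]|[f1 [f2 [fE -> ->]]]].
    have [x' [y' [h [-> mx ty]]]] := IH _ _ (esym ey).
    exists (fin g * x'), y', h; split=> //; first by rewrite mulgA.
    by rewrite -mulgA; exact: fineq_fin.
  exists 1, (fin g * w), f1; rewrite !mul1g; split=> //.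
    exact: fineq_refl.
  rewrite mulgA -finword_cat; apply: fineq_fin zw.
  by rewrite -e fE.
Qed.

Lemma fineq_fin_eval f w : fineq (fin f) w -> exists2 g, w = fin g & eval g = eval f.
Proof.
move ez: (fin f) => z zw.
elim: zw f ez => {z w} [|p x y _ IH|g g' x y e _ IH] f ez.
- by exists f.
- have [f1 [f2 [-> -> e2]]] := finword_factor ez.
  have [g -> eg] := IH _ (esym e2).
  by exists (f1 ++ g); rewrite ?finword_cat// !eval_cat eg.
- have [f1 [f2 [-> /finword_inj g1 e2]]] := finword_factor ez.
  have [h -> eh] := IH _ (esym e2).
  by exists (g' ++ h); rewrite ?finword_cat// !eval_cat eh -e g1.
Qed.

Lemma reduced_factor p x q : G_reduced (p * x * q) -> G_reduced x.
Proof.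
move=> xR p' q' f xE; apply: (xR (p * p') (q' * q)).
by rewrite xE !mulgA.
Qed.

(** Two finite prefixes of a reduced word differ by a finite factor, which is
    empty as soon as its value is 1. *)
Lemma reduced_fin_prefix u x y f g : G_reduced u -> u = fin f * x ->
  u = fin g * y -> eval f = eval g -> f = g /\ x = y.
Proof.
move=> + uE uE'; rewrite {1}uE.
have e : fin f * x = fin g * y by rewrite -uE.
clear uE uE'; case: (finword_levi e) => [[m fE ->]|[f1 [f2 [-> /finword_inj -> ->]]]].
  have [h1 [h2 [-> /finword_inj <- ->]]] := finword_factor fE.
  rewrite finword_cat eval_cat => uR eh.
  have h20 : eval h2 = 1 by apply: (mulgI (eval g)); rewrite mulg1.
  by rewrite (uR _ _ _ erefl h20) cats0 finword_nil mul1g.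
rewrite !eval_cat mulgA => uR eh.
have h20 : eval f2 = 1 by apply: (mulgI (eval f1)); rewrite mulg1.
by rewrite (uR _ _ _ erefl h20) cats0 finword_nil mul1g.
Qed.

(** Read the alignment of u * x with u * y from the left.  As long as both sides
    stay inside u, two finite blocks facing each other are prefixes of the same
    reduced word, hence equal, so the alignment is the identity on u until what
    remains of u is finite, and then u can be cancelled as an element of G.
    This fails for arbitrary u: if X has length t_1, with the letter b at
    the positions n t_0 and c at the positions t_1 - n t_0, and if b has order 3
    in G, then X c c c = b b b X is equivalent to X, but c c c need not be
    trivial. *)
Lemma fineq_cancel u x y : G_reduced u -> fineq (u * x) (u * y) -> fineq x y.
Proof.
move ez: (u * x) => z; move ew: (u * y) => w uR zw.
elim: zw u x y uR ez ew => {z w} [|p z w zw IH|f g z w e zw IH] u x y uR ez ew.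
- have [_ ->] := word1_factor ez; have [_ ->] := word1_factor ew; exact: fineq1.
- case: (word_levi ez) => [m [[uE zE]|[pE xE]]].
    move: ew uR; rewrite uE -mulgA => /wmulgI ew uR.
    by apply: IH (esym zE) ew; apply: (@reduced_factor p m 1); rewrite mulg1.
  by move: ew; rewrite xE pE -mulgA => /wmulgI ->; exact: fineq_same.
- case: (finword_levi ez) => [[m uE zE]|[f1 [f2 [fE uE xE]]]];
    case: (finword_levi ew) => [[m' uE' wE]|[g1 [g2 [gE uE' yE]]]].
  + have [fg mm] := reduced_fin_prefix uR uE uE' e.
    rewrite -mm in wE; apply: IH (esym zE) (esym wE).
    by apply: (@reduced_factor (fin f) m 1); rewrite mulg1 -uE.
  + have [h1 [h2 [g1E /finword_inj h1E mE]]] := finword_factor (etrans (esym uE') uE).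
    rewrite yE; apply: fineq_sym; rewrite -(mul1g x) -finword_nil.
    apply: (fineq_head (fineq_sym zw)); first by rewrite zE mE.
    rewrite eval_nil; apply: mulg_eq1C; apply: (mulgI (eval f)).
    by rewrite mulg1 {2}e gE g1E -h1E !eval_cat mulgA.
  + have [h1 [h2 [f1E /finword_inj h1E mE]]] := finword_factor (etrans (esym uE) uE').
    rewrite xE -(mul1g y) -finword_nil.
    apply: (fineq_head zw); first by rewrite wE mE.
    rewrite eval_nil; apply: mulg_eq1C; apply: (mulgI (eval g)).
    by rewrite mulg1 -{2}e fE f1E -h1E !eval_cat mulgA.
  + have fg1 : f1 = g1 by apply: (@finword_inj _ Omega); rewrite -uE.
    rewrite xE yE; apply: fineq_fin zw; apply: (mulgI (eval f1)).
    by rewrite -eval_cat -fE e gE eval_cat fg1.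
Qed.

(** Read the alignment of y with the involute of x from the left.  The finite
    blocks near the cut must be empty because x * y is reduced, and then a
    common first letter a would give a factor bar(a) a of value 1; so x has to
    be used up by finite blocks. *)
Lemma reduced_pal x y f : G_reduced (x * y) -> fineq y (wbar x * fin f) ->
  exists g, x = fin g.
Proof.
move=> + xy; move: xy; move ew: (wbar x * fin f) => w yw.
elim: yw x f ew => {y w} [|r y w yw IH|g g' y w e yw IH] x f ew xR.
- have [x1 _] := word1_factor ew; exists [::].
  by rewrite finword_nil -(wbarK (@barK _ Sigma) x) x1 wbar1.
- case: (word_cases r) ew xR => [->|[a [r' ->]]] ew xR.
    by rewrite !mul1g in ew xR; exact: IH ew xR.
  case: (word_cases (wbar x)) ew => [x1|[b [x' xE]]] ew.
    by exists [::]; rewrite finword_nil -(wbarK (@barK _ Sigma) x) x1 wbar1.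
  rewrite xE -!mulgA in ew; have [ba _] := wletter_inj ew.
  have xE' : x = wbar x' * fin [:: bar a].
    rewrite -(wbarK (@barK _ Sigma) x) xE wbarM ba; congr (_ * _).
    have -> : wletter a = fin [:: a] by rewrite finword_cons finword_nil mulg1.
    by rewrite wbar_fin.
  suff: [:: bar a; a] = [::] by [].
  apply: (xR (wbar x') (r' * y)).
    by rewrite xE' !finword_cons finword_nil !mulg1 !mulgA.
  by rewrite /eval !big_cons big_nil mulg1 /= mulVg.
- case: (finword_levi ew) => [[m xE wE]|[f1 [f2 [g'E xE wE]]]]; last first.
    exists (finv f1).
    by rewrite -(wbarK (@barK _ Sigma) x) xE wbar_fin.
  have xE' : x = wbar m * fin (finv g').
    by rewrite -(wbarK (@barK _ Sigma) x) xE wbarM wbar_fin.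
  have g0 : finv g' ++ g = [::].
    apply: (xR (wbar m) y); first by rewrite xE' finword_cat !mulgA.
    by rewrite eval_cat eval_bar e mulVg.
  move/(congr1 size)/eqP: g0.
  rewrite size_cat size_rev size_map addn_eq0 !size_eq0 => /andP[/eqP g'0 /eqP g0].
  move: xE' xR; rewrite g'0 g0 /= !finword_nil mulg1 => -> xR.
  apply: (IH _ f); first by rewrite wbarK ?wE//; exact: barK.
  by rewrite mul1g in xR.
Qed.

End FiniteReplacement.

(** * The monoid of words up to finite replacement *)

Section WordMonoid.
Context {disp : Order.disp_t} (Omega : bOrderType disp).
Context {G : groupType} (Sigma : set G).
Local Notation W := (word Omega (Gamma Sigma)).
Local Notation fin := (@finword _ Omega (Gamma Sigma)).
Local Notation wbar := (@wbar _ Omega (Gamma Sigma) (@bar _ Sigma)).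
Local Notation finv f := (rev [seq bar a | a <- f]).

Definition fineqb : rel W := fun x y => `[< fineq x y >].

Let fineqb_refl : reflexive fineqb.
Proof. by move=> x; apply/asboolP; exact: fineq_refl. Qed.
Let fineqb_sym : symmetric fineqb.
Proof. by move=> x y; apply/asboolP/asboolP; exact: fineq_sym. Qed.
Let fineqb_trans : transitive fineqb.
Proof.
by move=> y x z /asboolP xy /asboolP yz; apply/asboolP; exact: fineq_trans yz.
Qed.

Canonical fineq_equiv := EquivRel fineqb fineqb_refl fineqb_sym fineqb_trans.

(** Written as a star monoid, so that ^-1 is the involution. *)
Definition wordG : Type := {eq_quot fineq_equiv}%qT.
HB.instance Definition _ := Choice.on wordG.
HB.instance Definition _ := EqQuotient.on wordG.

Definition cls (w : W) : wordG := \pi_(wordG)%qT w.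

Lemma cls_eqP (x y : W) : cls x = cls y <-> fineq x y.
Proof.
have h : reflect (cls x = cls y) (fineqb x y).
  exact: (@eqquotP _ fineq_equiv wordG x y).
split=> [e|xy]; last by apply/h/asboolP.
by apply/asboolP; apply/h.
Qed.

Lemma cls_surj (m : wordG) : exists w, m = cls w.
Proof. by exists (repr m); rewrite /cls reprK. Qed.

Definition wordG_mul (m n : wordG) : wordG := cls (repr m * repr n).
Definition wordG_inv (m : wordG) : wordG := cls (wbar (repr m)).

Let mulE x y : wordG_mul (cls x) (cls y) = cls (x * y).
Proof. by apply/cls_eqP/fineqM; apply/cls_eqP; rewrite /cls reprK. Qed.

Let invE x : wordG_inv (cls x) = cls (wbar x).
Proof. by apply/cls_eqP/fineq_bar; apply/cls_eqP; rewrite /cls reprK. Qed.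

Let wordG_mulA : associative wordG_mul.
Proof.
move=> m n o; have [x ->] := cls_surj m; have [y ->] := cls_surj n.
by have [z ->] := cls_surj o; rewrite !mulE mulgA.
Qed.
Let wordG_mul1 : left_id (cls 1) wordG_mul.
Proof. by move=> m; have [x ->] := cls_surj m; rewrite mulE mul1g. Qed.
Let wordG_invK : involutive wordG_inv.
Proof.
by move=> m; have [x ->] := cls_surj m; rewrite !invE wbarK//; exact: barK.
Qed.
Let wordG_invM : {morph wordG_inv : x y / wordG_mul x y >-> wordG_mul y x}.
Proof.
move=> m n; have [x ->] := cls_surj m; have [y ->] := cls_surj n.
by rewrite mulE !invE mulE wbarM.
Qed.

HB.instance Definition _ :=
  isStarMonoid.Build wordG wordG_mulA wordG_mul1 wordG_invK wordG_invM.

Lemma clsM x y : cls (x * y) = cls x * cls y.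
Proof. exact/esym/mulE. Qed.

Lemma clsV x : (cls x)^-1 = cls (wbar x).
Proof. exact: invE. Qed.

(** The copy of G in [wordG]: its elements are units and their inverse is given
    by the involution. *)
Definition gcls f := cls (fin f).

Lemma gcls_eval f g : eval f = eval g -> gcls f = gcls g.
Proof. by move=> e; apply/cls_eqP; exact: fin_fineq. Qed.

Lemma gcls_cat f g : gcls (f ++ g) = gcls f * gcls g.
Proof. by rewrite /gcls finword_cat clsM. Qed.

Lemma gclsV f : (gcls f)^-1 = gcls (finv f).
Proof. by rewrite /gcls clsV wbar_fin. Qed.

Lemma gcls_eval1 f : eval f = 1 -> gcls f = 1.
Proof.
move=> f1; rewrite (@gcls_eval f [::]) ?f1 ?eval_nil//.
by rewrite /gcls finword_nil.
Qed.

Lemma gclsKV f : gcls f * (gcls f)^-1 = 1.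
Proof.
by rewrite gclsV -gcls_cat; apply: gcls_eval1; rewrite eval_cat eval_finv.
Qed.

Lemma gclsVK f : (gcls f)^-1 * gcls f = 1.
Proof.
rewrite gclsV -gcls_cat; apply: gcls_eval1.
by rewrite eval_cat eval_bar mulVg.
Qed.

(** The finite correction in [fineq_split] is a unit of [wordG], so the middle
    factor absorbs it. *)
Lemma wordG_levi : levi_prop wordG.
Proof.
move=> m n o k; have [x ->] := cls_surj m; have [y ->] := cls_surj n.
have [z ->] := cls_surj o; have [t ->] := cls_surj k.
rewrite -!clsM => /cls_eqP/fineq_split[x' [y' [f [e /cls_eqP xE /cls_eqP yE]]]].
rewrite !clsM -/(gcls f) in xE yE.
have {}yE : cls y = (gcls f)^-1 * cls y' by rewrite -yE mulgA gclsVK mul1g.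
case: (word_levi e) => [w [[e1 e2]|[e1 e2]]]; rewrite xE yE e1 e2 !clsM.
- exists ((gcls f)^-1 * cls w); right; rewrite !mulgA; split=> //.
  by rewrite -(mulgA (cls x')) gclsKV mulg1.
- exists (cls w * gcls f); left; rewrite !mulgA; split=> //.
  by rewrite -(mulgA (cls w)) gclsKV mulg1.
Qed.

(** The multiplication by elements of G on both sides makes the set closed under
    factors, since by [fineq_split] factors are only determined up to G. *)
Definition reducedG (m : wordG) : Prop :=
  exists f u g, G_reduced u /\ m = gcls f * cls u * gcls g.

Lemma reducedG_cls u : G_reduced u -> reducedG (cls u).
Proof.
move=> uR; exists [::], u, [::]; split=> //.
by rewrite (@gcls_eval1 [::]) ?eval_nil// mulg1 mul1g.
Qed.

Lemma reducedG_inv m : reducedG m -> reducedG m^-1.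
Proof.
move=> [f [u [g [uR ->]]]]; exists (finv g), (wbar u), (finv f).
by split; [exact: reduced_bar|rewrite !invgM !gclsV clsV mulgA].
Qed.

Lemma reducedG_split m n : reducedG (m * n) ->
  exists f x y g h, [/\ G_reduced (x * y), m = gcls f * cls x * gcls g
    & n = (gcls g)^-1 * cls y * gcls h].
Proof.
move=> [f [u [g [uR e]]]].
have e' : cls u = ((gcls f)^-1 * m) * (n * (gcls g)^-1).
  rewrite mulgA -(mulgA _ m) e !mulgA gclsVK mul1g.
  by rewrite -mulgA gclsKV mulg1.
have [a aE] := cls_surj ((gcls f)^-1 * m).
have [b bE] := cls_surj (n * (gcls g)^-1).
move: e'; rewrite aE bE -clsM => /esym/cls_eqP/fineq_split.
move=> [x [y [h [uxy /cls_eqP ax /cls_eqP byE]]]].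
exists f, x, y, h, g; split; first by rewrite -uxy.
  by rewrite -mulgA -[gcls h]/(cls (fin h)) -(clsM x) -ax -aE mulgA gclsKV mul1g.
by rewrite -byE clsM -bE !mulgA gclsVK mul1g -mulgA gclsVK mulg1.
Qed.

Lemma reducedG_factorl m n : reducedG (m * n) -> reducedG m.
Proof.
move=> /reducedG_split[f [x [y [g [h [uR -> _]]]]]].
exists f, x, g; split=> //; apply: (@reduced_factor _ _ _ _ 1 x y).
by rewrite mul1g.
Qed.

Lemma reducedG_pal m : reducedG (m * m^-1) -> m * m^-1 = 1.
Proof.
move=> /reducedG_split[f [x [y [g [h [uR mE mE']]]]]].
have yE : cls y = cls (wbar x * fin (finv f ++ finv h)).
  have -> : cls y = gcls g * m^-1 * (gcls h)^-1.
    by rewrite mE' !mulgA gclsKV mul1g -mulgA gclsKV mulg1.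
  rewrite mE !invgM (clsV x) clsM -/(gcls _) gcls_cat -!gclsV !mulgA.
  by rewrite gclsKV mul1g.
have [k xk] := reduced_pal uR ((cls_eqP _ _).1 yE).
rewrite mE xk -/(gcls k) -!gcls_cat; exact: gclsKV.
Qed.

Lemma reducedG_lcancel m x y : reducedG m -> m * x = m * y -> x = y.
Proof.
move=> [f [u [g [uR ->]]]]; rewrite -!mulgA => e.
have {}e : cls u * (gcls g * x) = cls u * (gcls g * y).
  by have := congr1 (mul (gcls f)^-1) e; rewrite ![_ * (gcls f * _)]mulgA gclsVK !mul1g.
have {}e : gcls g * x = gcls g * y.
  have [a aE] := cls_surj (gcls g * x); have [b bE] := cls_surj (gcls g * y).
  move: e; rewrite aE bE -!clsM => /cls_eqP/(fineq_cancel uR) ab.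
  exact/cls_eqP.
by have := congr1 (mul (gcls g)^-1) e; rewrite !mulgA gclsVK !mul1g.
Qed.

Lemma gcls_factor f m n : gcls f = m * n ->
  exists f1 f2, m = gcls f1 /\ n = gcls f2.
Proof.
have [x ->] := cls_surj m; have [y ->] := cls_surj n; rewrite -clsM.
move=> /cls_eqP/fineq_fin_eval[g /esym/finword_factor[f1 [f2 [_ -> ->]]] _].
by exists f1, f2.
Qed.

(** Every factor u of an element of G is in G, so u u^-1 is already 1 and a
    rewriting step has no effect. *)
Lemma gcls_irreducible f m : reduces reducedG (gcls f) m -> m = gcls f.
Proof.
move e: (gcls f) => z zm; elim: zm e => // {z m} x y z [p u q _] _ IH e.
have [f1 [_ [/esym/gcls_factor[f2 [_ [/esym/gcls_factor[_ [k [_ uE]]] _]]] _]]] :=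
  gcls_factor e.
have pq : p * u * u^-1 * q = p * q by rewrite -(mulgA p) uE gclsKV mulg1.
by rewrite pq in e *; exact: IH.
Qed.

Lemma gcls_inj f g : gcls f = gcls g -> eval f = eval g.
Proof. by move=> /cls_eqP/fineq_fin_eval[h /finword_inj ->]. Qed.

Lemma reducedG_joinable_trans x y z : joinable reducedG x y ->
  joinable reducedG y z -> joinable reducedG x z.
Proof.
apply: joinable_trans; [exact: wordG_levi|exact: reducedG_factorl|
  exact: reducedG_inv|exact: reducedG_pal|exact: reducedG_lcancel].
Qed.

(** Both sides of a defining relation have a common reduct because
    u l bar(r) bar(u) equals u u^-1 in [wordG]; confluence makes this stable
    under transitivity. *)
Lemma Mcong_joinable x y : Mcong x y -> joinable reducedG (cls x) (cls y).
Proof.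
elim=> {x y} [u l r uR e|x|x y _|x y z _ + _|x x' y y' _ + _].
- exists 1; last exact: reduces_refl.
  apply: reduces_cons (reduces_refl _ _).
  apply: (cancelsP (p := 1) (q := 1) (reducedG_cls uR)); last by rewrite mulg1.
  rewrite mul1g mulg1 wbar_fin !clsM clsV -(mulgA (cls u)) -gcls_cat.
  by rewrite gcls_eval1 ?mulg1// eval_cat eval_bar e mulgV.
- exact: joinable_refl.
- exact: joinable_sym.
- exact: reducedG_joinable_trans.
- by rewrite !clsM; exact: joinableM.
Qed.

Lemma Mcong_fin_eval f g : Mcong (fin f) (fin g) -> eval f = eval g.
Proof.
by move=> /Mcong_joinable[m /gcls_irreducible fm /gcls_irreducible gm];
  apply: gcls_inj; rewrite -fm.
Qed.

Lemma eval_Mcong f g : eval f = eval g -> Mcong (fin f) (fin g).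
Proof.
move=> e; have rel l r : eval l = eval r -> Mcong (fin (l ++ finv r)) 1.
  have /Mcong_rel h : G_reduced (1 : W).
    move=> p q k /esym/word1_factor[/word1_factor[_ k1] _] _.
    by apply: (@finword_inj _ Omega); rewrite k1 finword_nil.
  by move=> /h; rewrite wbar_fin wbar1 mul1g mulg1 finword_cat.
have fgg : Mcong (fin (f ++ finv g ++ g)) (fin g).
  rewrite catA finword_cat -[X in Mcong _ X]mul1g.
  by apply: McongM (Mcong_refl _); exact: rel.
apply: Mcong_trans fgg; rewrite finword_cat -[X in Mcong X _]mulg1.
apply: McongM (Mcong_refl _) _; apply: Mcong_sym.
have := @rel (finv g) (finv g) erefl.
by rewrite map_rev revK mapK//; exact: barK.
Qed.

End WordMonoid.

Theorem corollary5p5 (disp : Order.disp_t) (Omega : bOrderType disp)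
    (Omega_wf : well_founded (fun i j : Omega => (i < j)%O))
    (G : groupType) (Sigma : set G)
    (Sigma_gen : generates Sigma)
    (Sigma_neq1 : forall a : G, Sigma a -> a <> 1%g) :
  exists phi : {multiplicative G -> groupE Omega Sigma},
    (forall w : seq.seq (Gamma Sigma),
       val (phi (eval w)) = Mclass (finword w)) /\
    injective phi.
Proof.
have spell x : exists w : seq (Gamma Sigma), eval w = x.
  suff : [set x | exists w : seq (Gamma Sigma), eval w = x]%classic = setT.
    by move=> h; have : setT x by []; rewrite -h.
  apply: Sigma_gen => [a aS|||y [w <-]].
  - have aG : a \in (Sigma `|` [set x^-1 | x in Sigma])%classic.
      by rewrite inE; left.
    by exists [:: exist _ a aG]; rewrite /eval big_seq1.
  - by exists [::]; exact: eval_nil.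
  - by move=> y z [v <-] [w <-]; exists (v ++ w); rewrite eval_cat.
  - by exists (rev [seq bar a | a <- w]); rewrite eval_bar.
(* A single letter is reduced because it is not 1 in G, so every finite word is a
   product of reduced words. *)
have RfinG (w : seq (Gamma Sigma)) : groupE_set (Mclass (finword w : word Omega _)).
  rewrite /groupE_set inE; exists (finword w) => //.
  elim: w => [|a w IH]; first by rewrite finword_nil; exact: Rstar1.
  rewrite finword_cons; apply: RstarM IH; apply: Rstar_reduced.
  move=> p q f aE f1.
  have : finword [:: a] = p * finword f * q.
    by rewrite finword_cons finword_nil mulg1.
  move=> /finword_factor[w1 [w2 [aw /esym/finword_factor[w3 [w4 [w1E _ fE]]] _]]].
  have {fE} fE : f = w4 by exact: finword_inj fE.
  move: aw f1; rewrite w1E -fE; case: f {aE w1E fE} => // b [|c f].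
  - case: w3 => [|? w3]; last first.
      by move=> /(congr1 size)/=; rewrite !size_cat /= addn1 addSn.
    move=> [<- _].
    rewrite /eval big_seq1 => a1; have := valP a; rewrite inE => -[/Sigma_neq1//|].
    by move=> [x /Sigma_neq1 x1] xa; case: x1; rewrite -(invgK x) xa a1 invg1.
  - by move=> /(congr1 size)/=; rewrite !size_cat /= !addnS !addSn.
pose rep x := projT1 (cid (spell x)).
have repK x : eval (rep x) = x by rewrite /rep; case: cid.
pose phi x : groupE Omega Sigma := 
  exist (@groupE_set _ Omega _ Sigma) _ (RfinG (rep x)).
have phiE w : val (phi (eval w)) = Mclass (finword w).
  by apply/Mclass_eqP/eval_Mcong/repK.
have phiM : {morph phi : x y / x * y}.
  move=> x y; apply: val_inj; rewrite valM -{1}(repK x) -{1}(repK y) -eval_cat.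
  by rewrite phiE finword_cat MclassM.
pose phi_mul := isMultiplicative.Build G (groupE Omega Sigma) phi phiM.
pose phi_hom : {multiplicative G -> groupE Omega Sigma} := HB.pack phi phi_mul.
exists phi_hom; split=> // x y /(congr1 val).
by move=> /Mclass_eqP/Mcong_fin_eval; rewrite !repK.
Qed.
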